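(* Let $n \ge 2$ be an integer with $n \equiv 0, 2$ or $3 \pmod 4$. Then there exists a pair $(x,t)$ of positive integers such that $F_{x,t}^{(4)}(n) = 0$, and, setting \[ y = z = t(4x-n), \] $y$ and $z$ are positive integers satisfying \[ \frac{4}{n} = \frac{1}{x} + \frac{1}{y} + \frac{1}{z}. \]
   Context: For positive integers $x,t$ and a natural number $n$, define \[ F_{x,t}^{(4)}(n) = t^2(4x-n)^2 - 2nxt. \] A solution of $\frac{4}{n} = \frac{1}{x} + \frac{1}{y} + \frac{1}{z}$ means a solution in positive integers $x,y,z$; it is called symmetric if $y=z$. *)

(* Defs.v *)
From mathcomp Require Import all_boot all_order all_algebra.
Set Implicit Arguments.
Unset Strict Implicit.
Unset Printing Implicit Defensive.
Import Order.TTheory GRing.Theory Num.Theory.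
Local Open Scope ring_scope.

(* The value is an integer and the subtraction 4x - n takes place in [int],
   not as the truncated subtraction of [nat]. *)
Definition F4 (x t n : nat) : int :=
  t%:Z ^+ 2 * (4 * x%:Z - n%:Z) ^+ 2 - 2 * n%:Z * x%:Z * t%:Z.

(* Main.v *)
Require Import Defs.
From mathcomp Require Import all_boot all_order all_algebra.
From mathcomp Require Import zify ring.
Import Order.TTheory GRing.Theory Num.Theory.
Local Open Scope ring_scope.

(* With d = 4x - n > 0, the vanishing of F4 reads t d^2 = 2nx, that is
   2/(t d) = d/(nx) = 4/n - 1/x. For n = 2m take x = m and t = 1 (d = n);
   for n = 4k + 3 take x = k + 1 and t = 2nx (d = 1). *)

Lemma F4_root_symmetric_solution (n x t : nat) :
  (0 < n)%N -> (0 < x)%N -> (0 < t)%N -> (n < 4 * x)%N -> F4 x t n = 0 ->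
  let y : int := t%:Z * (4 * x%:Z - n%:Z) in
  0 < y /\ 4 / n%:Q = 1 / x%:Q + 1 / y%:Q + 1 / y%:Q.
Proof.
move=> n0 x0 t0 ltn4x F0 y.
have y0 : 0 < y by apply: mulr_gt0; lia.
split=> //.
(* With d = 4x - n and [y] = t d, [F4 x t n] factors as t (y d - 2nx), and the nonzero factor t
   cancels. *)
have hyd : y * (4 * x%:Z - n%:Z) = 2 * n%:Z * x%:Z.
  have tN0 : t%:Z != 0 by lia.
  apply: (mulfI tN0); apply/eqP; rewrite -subr_eq0 -F0 /F4 /y.
  by apply/eqP; ring.
clearbody y.
have hydQ : y%:Q * (4 * x%:Q - n%:Q) = 2 * n%:Q * x%:Q.
  by have := congr1 (fun i : int => i%:Q) hyd; rewrite !(rmorphM, rmorphB).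
have nN0 : n%:Q != 0 by rewrite intr_eq0; lia.
have xN0 : x%:Q != 0 by rewrite intr_eq0; lia.
have yN0 : y%:Q != 0 by rewrite intr_eq0 gt_eqF.
(* This removes [y] from the goal, leaving an identity in n and x alone. *)
have -> : 1 / y%:Q = (4 * x%:Q - n%:Q) / (2 * n%:Q * x%:Q).
  apply/eqP; rewrite eqr_div ?mulf_neq0 // mul1r -hydQ.
  by apply/eqP; ring.
by field; rewrite nN0 xN0.
Qed.

Theorem proposition3 (n : nat) (hn : (2 <= n)%N)
    (hmod : (n = 0 %[mod 4])%N \/ (n = 2 %[mod 4])%N \/ (n = 3 %[mod 4])%N) :
  exists x t : nat,
    [/\ (0 < x)%N, (0 < t)%N, F4 x t n = 0 &
        let y : int := t%:Z * (4 * x%:Z - n%:Z) in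
        let z : int := y in
        [/\ 0 < y, 0 < z &
            4 / n%:Q = 1 / x%:Q + 1 / y%:Q + 1 / z%:Q]].
Proof.
(* The bound n < 4x is added because [F4] sees d only through its square, while [y] > 0 needs d >
   0. *)
suff [x [t [x0 t0 ltn4x F0]]] : exists x t : nat,
    [/\ (0 < x)%N, (0 < t)%N, (n < 4 * x)%N & F4 x t n = 0].
  exists x, t; split=> //.
  by have [|y0 e] := @F4_root_symmetric_solution n x t _ x0 t0 ltn4x F0; first lia.
(* Residues 0 and 2 merge into the even case. *)
have [[m def_n] | [k def_n]] : (exists m, n = 2 * m)%N \/ (exists k, n = 4 * k + 3)%N.
  case: hmod => [h|[h|h]]; [left; exists (n %/ 2)%N|left; exists (n %/ 2)%N|
    right; exists (n %/ 4)%N]; lia.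
- exists m, 1%N; split; [lia|lia|lia|].
  by rewrite /F4 def_n PoszM; ring.
(* Here k + 1 is the least integer above n/4; since d = 1, the equation t d^2 = 2nx directly gives
   t. *)
- exists k.+1, (2 * n * k.+1)%N; split; [lia|lia|lia|].
  have d1 : 4 * k.+1%:Z - n%:Z = 1 by lia.
  by rewrite /F4 d1 !PoszM; ring.
Qed.
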